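(* Let $q\in(0,1)$ and $|x|<\frac{1}{(1-q)^2}$. Then the normalized $q$-Dunkl kernel satisfies the Turán type inequality: for all $\nu>0$, $$\left[\widetilde{E}_{\nu+1}(x;q^2)\right]^2\le\widetilde{E}_\nu(x;q^2)\,\widetilde{E}_{\nu+2}(x;q^2).$$
   Context: Let $q\in(0,1)$. Notation: $(a;p)_0=1$, $(a;p)_k=\prod_{j=0}^{k-1}(1-ap^j)$, $(a;p)_\infty=\prod_{j\ge0}(1-ap^j)$; $[a]_p=\frac{1-p^a}{1-p}$; the $p$-Gamma function is $\Gamma_p(x)=\frac{(p;p)_\infty}{(p^x;p)_\infty}(1-p)^{1-x}$. The $q$-modified Bessel function of the first kind is given by $$I^{(1)}_\nu\left((1-q^2)z;q^2\right)=\frac{1}{\Gamma_{q^2}(\nu+1)}\sum_{k=0}^\infty\frac{(1-q^2)^{2k}z^{2k+\nu}}{2^{2k+\nu}(q^2;q^2)_k(q^{2\nu+2};q^2)_k},\qquad |z|<\frac{1}{1-q^2},$$ and the normalized $q$-modified Bessel function of the first kind is $$\mathcal{I}_\nu(z;q^2)=(1+q)^\nu\frac{\Gamma_{q^2}(\nu+1)}{z^\nu}I^{(1)}_\nu\left(2(1-q)z;q^2\right).$$ For $|x|<\frac{1}{(1-q)^2}$, the $q$-Dunkl kernel is defined by $$E_\nu(x;q^2)=\mathcal{I}_\nu(x;q^2)+\frac{x}{(1+q)[\nu+1]_{q^2}}\,\mathcal{I}_{\nu+1}(x;q^2),$$ and the normalized $q$-Dunkl kernel is defined by $$\widetilde{E}_\nu(x;q^2)=\frac{E_\nu(x;q^2)}{C(\nu,q^2)},\qquad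 C(\nu,q^2)=\frac{(1+q)\,\Gamma_{q^2}(\nu+1)}{2\,\Gamma_{q^2}(\frac12)\,\Gamma_{q^2}(\nu+\frac12)}.$$ *)

(* Defs.v *)
(* Stdlib world: concrete reals, with Coquelicot for limits and series. *)
From Stdlib Require Import Reals Lra Lia.
From Coquelicot Require Import Coquelicot.
Open Scope R_scope.

Fixpoint qpoch (a p : R) (k : nat) : R :=
  match k with
  | O => 1
  | S j => qpoch a p j * (1 - a * p ^ j)
  end.

Definition qpoch_inf (a p : R) : R := real (Lim_seq (qpoch a p)).

Definition qnum (p a : R) : R := (1 - Rpower p a) / (1 - p).

Definition qGamma (p x : R) : R :=
  qpoch_inf p p / qpoch_inf (Rpower p x) p * Rpower (1 - p) (1 - x).

(* [qBesselI1 q nu w] is I^(1)_nu(w; q^2) for w > 0. The function is customarily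
   written at w = (1 - q^2) z, hence the local variable z. Real powers [Rpower]
   are meaningful only for a positive base. *)
Definition qBesselI1 (q nu w : R) : R :=
  let z := w / (1 - q ^ 2) in
  / qGamma (q ^ 2) (nu + 1) *
  Series (fun k : nat =>
    (1 - q ^ 2) ^ (2 * k) * Rpower z (2 * INR k + nu) /
    (Rpower 2 (2 * INR k + nu) * qpoch (q ^ 2) (q ^ 2) k *
     qpoch (Rpower q (2 * nu + 2)) (q ^ 2) k)).

(* In  (1+q)^nu Gamma_{q^2}(nu+1) z^(-nu) I^(1)_nu(2(1-q)z; q^2)  the factors
   z^nu cancel and only even powers of z remain, so for z < 0 the value is the
   one at |z| (whatever branch of z^nu is chosen), and the singularity at z = 0
   is removable with value 1; see [qBesselI_norm_series]. *)
Definition qBesselI_norm (q nu z : R) : R :=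
  if Req_EM_T z 0 then 1
  else Rpower (1 + q) nu * (qGamma (q ^ 2) (nu + 1) / Rpower (Rabs z) nu) *
       qBesselI1 q nu (2 * (1 - q) * Rabs z).

(* For nu > 0 the series converge exactly when |x| < 1/(1-q). Elsewhere [Series] takes
   Coquelicot's default value 0 (their partial sums tend to
   +infinity), so the kernel vanishes there. *)
Definition qDunkl (q nu x : R) : R :=
  qBesselI_norm q nu x +
  x / ((1 + q) * qnum (q ^ 2) (nu + 1)) * qBesselI_norm q (nu + 1) x.

Definition qDunkl_const (q nu : R) : R :=
  (1 + q) * qGamma (q ^ 2) (nu + 1) /
  (2 * qGamma (q ^ 2) (1 / 2) * qGamma (q ^ 2) (nu + 1 / 2)).

Definition qDunkl_norm (q nu x : R) : R := qDunkl q nu x / qDunkl_const q nu.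

Lemma qBesselI_norm_series (q nu z : R) :
  0 < q < 1 -> qGamma (q ^ 2) (nu + 1) <> 0 ->
  qBesselI_norm q nu z =
  Series (fun k : nat =>
    ((1 - q) * z) ^ (2 * k) /
    (qpoch (q ^ 2) (q ^ 2) k * qpoch (Rpower q (2 * nu + 2)) (q ^ 2) k)).
Proof.
intros Hq HG; unfold qBesselI_norm.
destruct (Req_EM_T z 0) as [->|Hz].
- symmetry; apply is_series_unique.
  match goal with |- is_series ?a _ => change (is_lim_seq (sum_n a) 1) end.
  apply is_lim_seq_ext with (u := fun _ => 1); [|apply is_lim_seq_const].
  intros n; induction n as [|n IH].
  + rewrite sum_O; simpl; field.
  + rewrite sum_Sn, <- IH, Rmult_0_r, pow_i by lia.
    unfold plus; simpl; unfold Rdiv; ring.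
- unfold qBesselI1.
  assert (Ha : 0 < Rabs z) by (apply Rabs_pos_lt; exact Hz).
  assert (Hq2 : 0 < 1 - q ^ 2) by nra.
  assert (HP : 0 < Rpower (Rabs z) nu) by apply exp_pos.
  assert (HQ : 0 < Rpower (1 + q) nu) by apply exp_pos.
  rewrite <- Rmult_assoc, <- Series_scal_l.
  apply Series_ext; intros k.
  assert (HE : 2 * (1 - q) * Rabs z / (1 - q ^ 2) = 2 * (Rabs z * / (1 + q)))
    by (field; split; nra).
  assert (Hi : 0 < / (1 + q)) by (apply Rinv_0_lt_compat; lra).
  assert (Hk : forall y, 0 < y ->
    Rpower y (2 * INR k + nu) = y ^ (2 * k) * Rpower y nu).
  { intros y Hy; rewrite Rpower_plus; f_equal.
    rewrite <- Rpower_pow by exact Hy; f_equal.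
    rewrite mult_INR; simpl; ring. }
  assert (HI : Rpower (/ (1 + q)) nu = / Rpower (1 + q) nu).
  { unfold Rpower; rewrite ln_Rinv by lra.
    rewrite <- exp_Ropp; f_equal; ring. }
  rewrite HE, <- Rpower_mult_distr by (try apply Rmult_lt_0_compat; lra).
  rewrite (Hk (Rabs z * / (1 + q))) by (apply Rmult_lt_0_compat; lra).
  rewrite <- (Rpower_mult_distr (Rabs z)) by lra.
  rewrite HI.
  assert (H2 : 0 < Rpower 2 (2 * INR k + nu)) by apply exp_pos.
  assert (HZ : (1 - q ^ 2) ^ (2 * k) * (Rabs z * / (1 + q)) ^ (2 * k)
               = ((1 - q) * z) ^ (2 * k)).
  { rewrite <- Rpow_mult_distr.
    replace ((1 - q ^ 2) * (Rabs z * / (1 + q))) with ((1 - q) * Rabs z)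
      by (field; lra).
    rewrite !pow_mult; f_equal.
    rewrite !Rpow_mult_distr, pow2_abs.
    reflexivity. }
  rewrite <- HZ; unfold Rdiv; rewrite !Rinv_mult.
  generalize (/ qpoch (q ^ 2) (q ^ 2) k)
    (/ qpoch (Rpower q (2 * nu + 2)) (q ^ 2) k); intros D1 D2.
  field; repeat split; lra.
Qed.

(* Main.v *)
(* Put p = q^2, t = (1 - q) x, b = q^(2 nu + 1) and let phi_b be the q-binomial series
   sum_j (b;p)_j / (p;p)_j s^j. Since phi_b(q p^k) / phi_b(q) = (q;p)_k / (bq;p)_k and
   (p;p)_k (q;p)_k = (q;q)_(2k), expanding phi_b(q p^k) and exchanging the sums gives
   phi_b(q) E_nu(x) = sum_j (b;p)_j / (p;p)_j q^j W_j(t) (a q-analogue of the Laplace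
   integral of the Dunkl kernel), where W_j(t) does not depend on nu. Positivity of
   1 / (y;q)_oo = sum_m y^m / (q;q)_m at y = t q^j and y = - t q^j makes W_j(t) nonnegative.
   Passing from nu to nu + 1 multiplies the j-th term by (1 - b p^j) / (1 - b), so the
   inequality is Cauchy-Schwarz combined with 1 - b p^j <= 1 - b p^(j+1). For |t| >= 1
   all the series diverge, so that [Series], hence each side, is 0 by convention. *)

Require Import Defs.
From Stdlib Require Import Reals Lra Lia.
From Coquelicot Require Import Coquelicot.
Open Scope R_scope.

(** * Real series: comparison, exchange of summations, Cauchy-Schwarz *)

Lemma ex_series_Rscal (c : R) (a : nat -> R) :
  ex_series a -> ex_series (fun n => c * a n).
Proof. intros H; exact (ex_series_scal_l c a H). Qed.

Lemma ex_series_Rplus (a b : nat -> R) :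
  ex_series a -> ex_series b -> ex_series (fun n => a n + b n).
Proof. intros Ha Hb; exact (ex_series_plus a b Ha Hb). Qed.

Lemma ex_series_Rabs_le (a b : nat -> R) :
  (forall n, Rabs (a n) <= b n) -> ex_series b -> ex_series a.
Proof. intros H Hb; exact (@ex_series_le R_AbsRing R_CompleteNormedModule a b H Hb). Qed.

Lemma Series_nonneg (a : nat -> R) :
  (forall n, 0 <= a n) -> ex_series a -> 0 <= Series a.
Proof.
intros Ha Hs; rewrite <- (Rmult_0_l (Series a)), <- Series_scal_l.
apply Series_le; auto.
intros n; specialize (Ha n); lra.
Qed.

Lemma Rabs_pow_le1 (p : R) (n : nat) : Rabs p <= 1 -> Rabs (p ^ n) <= 1.
Proof.
intros H; rewrite <- RPow_abs; generalize (Rabs_pos p); intros H0.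
induction n as [|n IH]; simpl; [lra|].
assert (0 <= Rabs p ^ n) by (apply pow_le; lra); nra.
Qed.

Lemma Rabs_bounded_pow_le (c : nat -> R) (M r : R) (n : nat) :
  (forall k, Rabs (c k) <= M) -> Rabs (c n * r ^ n) <= M * Rabs r ^ n.
Proof.
intros H; rewrite Rabs_mult, <- RPow_abs.
apply Rmult_le_compat_r; [apply pow_le, Rabs_pos|apply H].
Qed.

Lemma ex_series_Rabs_pow (M r : R) :
  Rabs r < 1 -> ex_series (fun n => M * Rabs r ^ n).
Proof. intros H; apply ex_series_Rscal, ex_series_geom; now rewrite Rabs_Rabsolu. Qed.

Lemma ex_series_bounded_pow (c : nat -> R) (M r : R) :
  (forall k, Rabs (c k) <= M) -> Rabs r < 1 -> ex_series (fun n => c n * r ^ n).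
Proof.
intros H Hr; apply ex_series_Rabs_le with (fun n => M * Rabs r ^ n).
- intros n; now apply Rabs_bounded_pow_le.
- now apply ex_series_Rabs_pow.
Qed.

Lemma Rabs_Series_bounded_pow (c : nat -> R) (M r : R) :
  (forall k, Rabs (c k) <= M) -> Rabs r < 1 ->
  Rabs (Series (fun n => c n * r ^ n)) <= M / (1 - Rabs r).
Proof.
intros H Hr; eapply Rle_trans.
- apply Series_Rabs.
  apply ex_series_Rabs_le with (fun n => M * Rabs r ^ n).
  + intros n; rewrite Rabs_Rabsolu; now apply Rabs_bounded_pow_le.
  + now apply ex_series_Rabs_pow.
- unfold Rdiv; rewrite <- Series_geom by now rewrite Rabs_Rabsolu.
  rewrite <- Series_scal_l; apply Series_le.
  + intros n; split; [apply Rabs_pos|now apply Rabs_bounded_pow_le].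
  + now apply ex_series_Rabs_pow.
Qed.

(** Finitely many columns can be exchanged by linearity. Beyond column [N] the remainder of row [m]
    is at most [u m] times the tail of [v], so the total error is at most that tail times
    [Series u], which tends to 0. *)
Lemma Series_exchange (f : nat -> nat -> R) (u v : nat -> R) :
  (forall m n, Rabs (f m n) <= u m * v n) -> ex_series u -> ex_series v ->
  Series (fun m => Series (fun n => f m n)) =
  Series (fun n => Series (fun m => f m n)).
Proof.
intros Hf Hu Hv.
assert (Hrow : forall m, ex_series (fun n => f m n)).
{ intros m; apply ex_series_Rabs_le with (fun n => u m * v n); auto.
  now apply ex_series_Rscal. }
assert (Hcol : forall n, ex_series (fun m => f m n)).
{ intros n; apply ex_series_Rabs_le with (fun m => v n * u m).
  - intros m; rewrite Rmult_comm; auto.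
  - now apply ex_series_Rscal. }
assert (Hpart : forall N, ex_series (fun m => sum_f_R0 (f m) N) /\
  sum_f_R0 (fun n => Series (fun m => f m n)) N = Series (fun m => sum_f_R0 (f m) N)).
{ induction N as [|N [IH1 IH2]]; simpl; [split; auto; apply Hcol|].
  split; [now apply ex_series_Rplus|].
  rewrite IH2, Series_plus; auto. }
set (T := fun N => Series v - sum_f_R0 v N).
assert (Htail : forall m N,
  Rabs (Series (fun n => f m n) - sum_f_R0 (f m) N) <= T N * u m).
{ intros m N; unfold T.
  rewrite (Series_incr_n (fun n => f m n) (S N)) by (lia || apply Hrow).
  rewrite (Series_incr_n v (S N)) by (lia || auto); cbn [Init.Nat.pred].
  change (fun n => f m n) with (f m).
  assert (Hv' : ex_series (fun k => v (S N + k)%nat))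
    by now apply (ex_series_incr_n v (S N)).
  replace (_ + _ - _) with (Series (fun k => f m (S N + k)%nat)) by ring.
  replace (_ + _ - _) with (Series (fun k => v (S N + k)%nat)) by ring.
  rewrite Rmult_comm, <- Series_scal_l.
  eapply Rle_trans; [apply Series_Rabs|].
  - apply ex_series_Rabs_le with (fun k => u m * v (S N + k)%nat).
    + intros k; rewrite Rabs_Rabsolu; apply Hf.
    + now apply ex_series_Rscal.
  - apply Series_le.
    + intros k; split; [apply Rabs_pos|apply Hf].
    + now apply ex_series_Rscal. }
assert (Hdiff : forall N, ex_series (fun m => Series (fun n => f m n) - sum_f_R0 (f m) N)).
{ intros N; apply ex_series_Rabs_le with (fun m => T N * u m); auto.
  now apply ex_series_Rscal. }
(* Each row sum is its entry in column 0 plus a remainder; both are summable in [m]. *)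
assert (Hrows : ex_series (fun m => Series (fun n => f m n))).
{ apply ex_series_ext with
    (fun m => (Series (fun n => f m n) - sum_f_R0 (f m) 0) + sum_f_R0 (f m) 0).
  - intros m; simpl; ring.
  - apply ex_series_Rplus; [apply Hdiff|apply Hpart]. }
symmetry; apply is_series_unique.
match goal with |- is_series ?a ?l => change (is_lim_seq (sum_n a) l) end.
set (L := Series (fun m => Series (fun n => f m n))).
assert (HT : is_lim_seq (fun N => T N * Series u) 0).
{ replace (Finite 0) with (Rbar_mult (Series v - Series v) (Series u))
    by (simpl; f_equal; ring).
  apply is_lim_seq_scal_r with (lu := Finite (Series v - Series v)).
  apply is_lim_seq_minus'; [apply is_lim_seq_const|].
  apply is_lim_seq_ext with (sum_n v); [intros; apply sum_n_Reals|].
  exact (Series_correct v Hv). }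
apply is_lim_seq_ext with
  (fun N => L - (L - sum_f_R0 (fun n => Series (fun m => f m n)) N)).
{ intros N; rewrite sum_n_Reals; ring. }
replace (Finite L) with (Finite (L - 0)) by (f_equal; ring).
apply is_lim_seq_minus'; [apply is_lim_seq_const|].
apply is_lim_seq_abs_0.
apply is_lim_seq_le_le with (fun _ => 0) (fun N => T N * Series u);
  [|apply is_lim_seq_const|exact HT].
intros N; split; [apply Rabs_pos|].
destruct (Hpart N) as [HpN ->]; unfold L.
rewrite <- Series_minus, <- Series_scal_l by auto.
eapply Rle_trans; [apply Series_Rabs|].
- apply ex_series_Rabs_le with (fun m => T N * u m).
  + intros m; rewrite Rabs_Rabsolu; apply Htail.
  + now apply ex_series_Rscal.
- apply Series_le.
  + intros m; split; [apply Rabs_pos|apply Htail].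
  + now apply ex_series_Rscal.
Qed.

(** The usual discriminant argument: the sum of [a n * (u n - l) ^ 2] is a quadratic in [l] that is
    never negative. The bound on [u] makes all three series converge by comparison with [a]. *)
Lemma Series_Cauchy_Schwarz (a u : nat -> R) :
  (forall n, 0 <= a n) -> (forall n, Rabs (u n) <= 1) -> ex_series a ->
  Series (fun n => a n * u n) ^ 2 <= Series a * Series (fun n => a n * u n ^ 2).
Proof.
intros Ha Hu Hs.
assert (H1 : ex_series (fun n => a n * u n)).
{ apply ex_series_Rabs_le with a; auto.
  intros n; rewrite Rabs_mult, (Rabs_pos_eq (a n)) by auto.
  specialize (Ha n); specialize (Hu n); nra. }
assert (H2 : ex_series (fun n => a n * u n ^ 2)).
{ apply ex_series_Rabs_le with a; auto.
  intros n; rewrite Rabs_mult, (Rabs_pos_eq (a n)) by auto.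
  specialize (Ha n); generalize (Rabs_pow_le1 (u n) 2 (Hu n)); nra. }
set (S0 := Series a); set (S1 := Series (fun n => a n * u n)).
set (S2 := Series (fun n => a n * u n ^ 2)).
assert (H0 : 0 <= S0) by now apply Series_nonneg.
assert (Hq : forall l, 0 <= S2 + (- 2 * l) * S1 + l ^ 2 * S0).
{ intros l; unfold S0, S1, S2; rewrite <- !Series_scal_l.
  rewrite <- !Series_plus by
    (repeat apply ex_series_Rplus; auto; now apply ex_series_Rscal).
  apply Series_nonneg.
  - intros n; specialize (Ha n).
    replace (_ + _) with (a n * (u n - l) ^ 2) by ring.
    apply Rmult_le_pos; [auto|apply pow2_ge_0].
  - repeat apply ex_series_Rplus; auto; now apply ex_series_Rscal. }
(* If [S0 > 0], the quadratic is evaluated at its minimizer [S1 / S0]. *)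
destruct H0 as [H0|H0].
- specialize (Hq (S1 / S0)).
  replace (_ + _) with (S2 - S1 ^ 2 / S0) in Hq by (field; lra).
  apply Rmult_le_reg_r with (/ S0); [now apply Rinv_0_lt_compat|].
  replace (S0 * S2 * / S0) with S2 by (field; lra).
  unfold Rdiv in Hq; lra.
- rewrite <- H0 in *.
  destruct (Req_dec S1 0) as [->|Hn]; [lra|].
  (* With [S0 = 0] the quadratic is affine in [l]; this [l] gives it the value -1, which excludes
     [S1 <> 0]. *)
  specialize (Hq ((S2 + 1) / (2 * S1))).
  replace (_ + _) with (-1) in Hq by (field; lra); lra.
Qed.

(** * Finite and infinite q-Pochhammer products *)

Lemma qpoch_bounds (a p : R) (k : nat) :
  0 <= a < 1 -> 0 <= p < 1 -> 0 < qpoch a p k <= 1.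
Proof.
intros Ha Hp; induction k as [|k IH]; simpl; [lra|].
generalize (Rabs_pow_le1 p k); rewrite !Rabs_pos_eq by (try apply pow_le; lra).
intros H; specialize (H ltac:(lra)).
assert (0 <= p ^ k) by (apply pow_le; lra).
assert (0 <= a * p ^ k < 1) by nra.
split; nra.
Qed.

Lemma qpoch_shift (a p : R) (k : nat) :
  qpoch a p (S k) = (1 - a) * qpoch (a * p) p k.
Proof.
induction k as [|k IH]; [simpl; ring|].
change (qpoch a p (S (S k))) with (qpoch a p (S k) * (1 - a * p ^ S k)).
rewrite IH; simpl; ring.
Qed.

Lemma qpoch_add (a p : R) (m n : nat) :
  qpoch a p (m + n) = qpoch a p m * qpoch (a * p ^ m) p n.
Proof.
induction n as [|n IH]; [rewrite Nat.add_0_r; simpl; ring|].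
rewrite Nat.add_succ_r; simpl; rewrite IH, pow_add; ring.
Qed.

(** Weierstrass product inequality: a product of factors [1 - x_j] with [x_j] in [0,1] is at least 1
    minus the sum of the [x_j], here a geometric sum. *)
Lemma qpoch_ge_linear (a p : R) (n : nat) :
  0 <= a < 1 -> 0 <= p < 1 -> 1 - a / (1 - p) <= qpoch a p n.
Proof.
intros Ha Hp.
assert (H : 1 - a * (1 - p ^ n) / (1 - p) <= qpoch a p n).
{ induction n as [|n IH]; [simpl; unfold Rdiv; lra|].
  generalize (qpoch_bounds a p n Ha Hp); simpl; intros HB.
  assert (0 <= p ^ n) by (apply pow_le; lra).
  replace (1 - a * (1 - p * p ^ n) / (1 - p))
    with (1 - a * (1 - p ^ n) / (1 - p) - a * p ^ n) by (field; lra).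
  assert (0 <= a * p ^ n) by nra; nra. }
eapply Rle_trans; [|exact H].
assert (0 <= p ^ n) by (apply pow_le; lra).
apply Rplus_le_compat_l, Ropp_le_contravar; unfold Rdiv.
apply Rmult_le_compat_r; [left; apply Rinv_0_lt_compat; lra|nra].
Qed.

(** The linear bound is positive only for small [a]. Splitting off the first [N] factors replaces
    [a] by [a * p ^ N], for which the bound is at least 1/2. This uniform bound gives both
    positivity of the infinite product and boundedness of the reciprocals. *)
Lemma qpoch_lower_bound (a p : R) :
  0 <= a < 1 -> 0 <= p < 1 -> exists d, 0 < d /\ forall n, d <= qpoch a p n.
Proof.
intros Ha Hp.
(* The threshold is chosen so that [a * p ^ N / (1 - p) <= 1 / 2]. *)
destruct (pow_lt_1_zero p) with (y := (1 - p) / 2) as [N HN];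
  [rewrite Rabs_pos_eq; lra|lra|].
specialize (HN N (le_n N)).
assert (HpN : 0 <= p ^ N) by (apply pow_le; lra).
rewrite Rabs_pos_eq in HN by lra.
generalize (qpoch_bounds a p N Ha Hp); intros HB.
exists (qpoch a p N / 2); split; [lra|].
assert (Htail : forall n, qpoch a p N / 2 <= qpoch a p (N + n)).
{ intros n; rewrite qpoch_add.
  assert (Hlin : 1 - a * p ^ N / (1 - p) <= qpoch (a * p ^ N) p n)
    by (apply qpoch_ge_linear; [split; nra|lra]).
  assert (a * p ^ N / (1 - p) <= 1 / 2).
  { apply Rmult_le_reg_r with (1 - p); [lra|].
    unfold Rdiv at 1; rewrite Rmult_assoc, Rinv_l by lra; nra. }
  unfold Rdiv; apply Rmult_le_compat_l; lra. }
assert (Hmono : forall n k, qpoch a p (n + k) <= qpoch a p n).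
{ intros n k; induction k as [|k IH]; [rewrite Nat.add_0_r; lra|].
  eapply Rle_trans; [|exact IH].
  rewrite Nat.add_succ_r; simpl.
  generalize (qpoch_bounds a p (n + k) Ha Hp); intros.
  assert (0 <= p ^ (n + k)) by (apply pow_le; lra).
  assert (0 <= a * p ^ (n + k)) by nra; nra. }
intros n; eapply Rle_trans; [apply (Htail n)|].
rewrite Nat.add_comm; apply Hmono.
Qed.

Lemma qpoch_inf_lim (a p : R) :
  0 <= a < 1 -> 0 <= p < 1 -> is_lim_seq (qpoch a p) (qpoch_inf a p).
Proof.
intros Ha Hp; apply Lim_seq_correct', ex_finite_lim_seq_decr with 0.
- intros n; simpl; generalize (qpoch_bounds a p n Ha Hp); intros.
  assert (0 <= p ^ n) by (apply pow_le; lra).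
  assert (0 <= a * p ^ n) by nra; nra.
- intros n; generalize (qpoch_bounds a p n Ha Hp); lra.
Qed.

Lemma qpoch_inf_pos (a p : R) :
  0 <= a < 1 -> 0 <= p < 1 -> 0 < qpoch_inf a p.
Proof.
intros Ha Hp; destruct (qpoch_lower_bound a p Ha Hp) as [d [Hd Hn]].
apply Rlt_le_trans with d; auto.
exact (is_lim_seq_le _ _ d (qpoch_inf a p) Hn
  (is_lim_seq_const d) (qpoch_inf_lim a p Ha Hp)).
Qed.

Lemma qpoch_inf_shift (a p : R) :
  0 <= a < 1 -> 0 <= p < 1 -> qpoch_inf a p = (1 - a) * qpoch_inf (a * p) p.
Proof.
intros Ha Hp.
assert (H1 : is_lim_seq (fun n => qpoch a p (S n)) (qpoch_inf a p)).
{ apply is_lim_seq_incr_1 with (u := qpoch a p); now apply qpoch_inf_lim. }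
assert (H2 : is_lim_seq (fun n => qpoch a p (S n)) ((1 - a) * qpoch_inf (a * p) p)).
{ apply is_lim_seq_ext with (fun n => (1 - a) * qpoch (a * p) p n);
    [intros; symmetry; apply qpoch_shift|].
  apply (is_lim_seq_scal_l _ (1 - a) (Finite (qpoch_inf (a * p) p))).
  apply qpoch_inf_lim; [split; nra|lra]. }
generalize (is_lim_seq_unique _ _ H1); rewrite (is_lim_seq_unique _ _ H2).
intros E; injection E; auto.
Qed.

(** * The q-Gamma function and the normalizing constant *)

Lemma Rpower_lt_1 (p y : R) : 0 < p < 1 -> 0 < y -> 0 < Rpower p y < 1.
Proof.
intros Hp Hy; split; [apply exp_pos|].
unfold Rpower; rewrite <- exp_0; apply exp_increasing.
assert (ln p < 0) by (rewrite <- ln_1; apply ln_increasing; lra); nra.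
Qed.

Lemma qGamma_pos (p y : R) : 0 < p < 1 -> 0 < y -> 0 < qGamma p y.
Proof.
intros Hp Hy; generalize (Rpower_lt_1 p y Hp Hy); intros.
unfold qGamma; apply Rmult_lt_0_compat; [|apply exp_pos].
apply Rdiv_lt_0_compat; apply qpoch_inf_pos; lra.
Qed.

Lemma qGamma_succ (p y : R) :
  0 < p < 1 -> 0 < y -> qGamma p (y + 1) = qnum p y * qGamma p y.
Proof.
intros Hp Hy; generalize (Rpower_lt_1 p y Hp Hy); intros HR.
unfold qGamma, qnum.
rewrite (qpoch_inf_shift (Rpower p y)) by lra.
rewrite Rpower_plus, Rpower_1 by lra.
replace (1 - y) with (1 - (y + 1) + 1) by ring.
rewrite Rpower_plus, Rpower_1 by lra.
assert (0 < qpoch_inf (Rpower p y * p) p) by (apply qpoch_inf_pos; [split; nra|lra]).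
field; lra.
Qed.

Lemma Rpower_sqr_base (q y : R) : 0 < q -> Rpower (q ^ 2) y = Rpower q (2 * y).
Proof.
intros Hq; rewrite <- Rpower_pow, Rpower_mult by exact Hq.
now f_equal; simpl; f_equal; ring.
Qed.

(** The functional equation of the q-Gamma function is applied to numerator and denominator; the
    ratio is [[nu+1]_p / [nu+1/2]_p] with [p = q ^ 2], whose common denominator [1 - p] cancels. *)
Lemma qDunkl_const_succ (q nu : R) : 0 < q < 1 -> 0 < nu ->
  qDunkl_const q (nu + 1) = qDunkl_const q nu *
    ((1 - Rpower q (2 * nu + 1) * q) / (1 - Rpower q (2 * nu + 1))).
Proof.
intros Hq Hnu; unfold qDunkl_const.
replace (nu + 1 + 1 / 2) with (nu + 1 / 2 + 1) by ring.
assert (Hp : 0 < q ^ 2 < 1) by (split; nra).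
rewrite !qGamma_succ by lra.
unfold qnum; rewrite !Rpower_sqr_base by lra.
replace (2 * (nu + 1)) with (2 * nu + 1 + 1) by ring.
replace (2 * (nu + 1 / 2)) with (2 * nu + 1) by field.
rewrite Rpower_plus, Rpower_1 by lra.
generalize (Rpower_lt_1 q (2 * nu + 1) Hq ltac:(lra)); intros HR.
generalize (qGamma_pos (q ^ 2) (1 / 2) Hp ltac:(lra)); intros H1.
generalize (qGamma_pos (q ^ 2) (nu + 1 / 2) Hp ltac:(lra)); intros H2.
field; repeat split; nra.
Qed.

(** * Signed bases, splitting by parity, bounded reciprocals *)

Lemma Rabs_mult_lt_1 (x y : R) : Rabs x < 1 -> Rabs y <= 1 -> Rabs (x * y) < 1.
Proof.
intros Hx Hy; rewrite Rabs_mult.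
generalize (Rabs_pos x) (Rabs_pos y); nra.
Qed.

Lemma qpoch_pos (a p : R) (k : nat) : Rabs a < 1 -> 0 <= p < 1 -> 0 < qpoch a p k.
Proof.
intros Ha Hp; induction k as [|k IH]; simpl; [lra|].
apply Rmult_lt_0_compat; [exact IH|].
assert (H : Rabs (a * p ^ k) < 1).
{ apply Rabs_mult_lt_1; [exact Ha|].
  apply Rabs_pow_le1; rewrite Rabs_pos_eq; lra. }
apply Rabs_def2 in H; lra.
Qed.

Lemma qpoch_zero (p : R) (k : nat) : qpoch 0 p k = 1.
Proof. induction k as [|k IH]; simpl; [|rewrite IH]; ring. Qed.

(** The factors [1 - q ^ i] are sorted by the parity of [i]: even exponents give base point [q ^ 2],
    odd ones base point [q]. *)
Lemma qpoch_even (q : R) (k : nat) :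
  qpoch q q (2 * k) = qpoch (q ^ 2) (q ^ 2) k * qpoch q (q ^ 2) k.
Proof.
induction k as [|k IH]; [simpl; ring|].
replace (2 * S k)%nat with (S (S (2 * k))) by lia.
cbn [qpoch]; rewrite IH, <- pow_mult.
rewrite <- !tech_pow_Rmult; ring.
Qed.

Lemma qpoch_odd (q : R) (k : nat) :
  qpoch q q (2 * k + 1) = qpoch (q ^ 2) (q ^ 2) k * qpoch q (q ^ 2) (S k).
Proof.
rewrite Nat.add_1_r; cbn [qpoch]; rewrite qpoch_even, <- pow_mult; ring.
Qed.

Lemma inv_qpoch_bounded (a p : R) :
  0 <= a < 1 -> 0 <= p < 1 -> exists M, 1 <= M /\ forall k, Rabs (/ qpoch a p k) <= M.
Proof.
intros Ha Hp; destruct (qpoch_lower_bound a p Ha Hp) as [d [Hd Hn]].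
exists (/ d); split.
- rewrite <- Rinv_1; apply Rinv_le_contravar; [exact Hd|exact (Hn 0%nat)].
- intros k; rewrite Rabs_pos_eq.
  + apply Rinv_le_contravar; auto.
  + left; apply Rinv_0_lt_compat; generalize (Hn k); lra.
Qed.

(** * The q-binomial series *)

(** The basic hypergeometric series 1phi0(b; -; p, s), equal to [(bs;p)_oo / (s;p)_oo] by the
    q-binomial theorem. Below it is handled through its functional equations rather than through
    this product. *)
Definition qbin (b p s : R) : R :=
  Series (fun j => qpoch b p j / qpoch p p j * s ^ j).

Lemma qbin_coef_bounded (b p : R) : 0 <= b < 1 -> 0 <= p < 1 ->
  exists M, 1 <= M /\ forall j, Rabs (qpoch b p j / qpoch p p j) <= M.
Proof.
intros Hb Hp; destruct (inv_qpoch_bounded p p Hp Hp) as [M [HM H]].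
exists M; split; auto; intros j; unfold Rdiv; rewrite Rabs_mult.
generalize (qpoch_bounds b p j Hb Hp) (H j) (Rabs_pos (/ qpoch p p j)); intros HB HJ HP.
rewrite (Rabs_pos_eq (qpoch b p j)) by lra; nra.
Qed.

Lemma qbin_ex_series (b p s : R) : 0 <= b < 1 -> 0 <= p < 1 -> Rabs s < 1 ->
  ex_series (fun j => qpoch b p j / qpoch p p j * s ^ j).
Proof.
intros Hb Hp Hs; destruct (qbin_coef_bounded b p Hb Hp) as [M [_ H]].
now apply ex_series_bounded_pow with M.
Qed.

(** The coefficients satisfy [c_(k+1) * (1 - p^(k+1)) = c_k * (1 - b * p^k)]. In the difference of
    the values at [s] and [s * p] the constant term vanishes, and the recurrence rewrites the
    remaining terms. *)
Lemma qbin_step (b p s : R) : 0 <= b < 1 -> 0 <= p < 1 -> Rabs s < 1 ->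
  (1 - s) * qbin b p s = (1 - b * s) * qbin b p (s * p).
Proof.
intros Hb Hp Hs.
assert (Hsp : Rabs (s * p) < 1)
  by (apply Rabs_mult_lt_1; [|rewrite Rabs_pos_eq]; lra).
generalize (qbin_ex_series b p s Hb Hp Hs) (qbin_ex_series b p _ Hb Hp Hsp).
intros E1 E2.
enough (H : qbin b p s - qbin b p (s * p) =
            s * qbin b p s + (- (b * s)) * qbin b p (s * p)) by lra.
unfold qbin; rewrite <- Series_minus, <- !Series_scal_l, <- Series_plus;
  try apply ex_series_Rscal; auto.
rewrite Series_incr_1.
- simpl (_ ^ 0); rewrite Rminus_diag, Rplus_0_l.
  apply Series_ext; intros k; cbn [qpoch pow]; rewrite Rpow_mult_distr.
  assert (0 < qpoch p p k * (1 - p * p ^ k))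
    by (apply (qpoch_pos p p (S k)); [rewrite Rabs_pos_eq; lra|lra]).
  field; split; intros E; rewrite E in *; lra.
- apply ex_series_ext with (fun n => qpoch b p n / qpoch p p n * s ^ n
    + (-1) * (qpoch b p n / qpoch p p n * (s * p) ^ n)); [intros; simpl; ring|].
  apply ex_series_Rplus; auto; now apply ex_series_Rscal.
Qed.

Lemma qbin_iter (b p s : R) (n : nat) : 0 <= b < 1 -> 0 <= p < 1 -> Rabs s < 1 ->
  qpoch s p n * qbin b p s = qpoch (b * s) p n * qbin b p (s * p ^ n).
Proof.
intros Hb Hp Hs; induction n as [|n IH]; [simpl; now rewrite Rmult_1_r|].
cbn [qpoch pow].
replace (s * (p * p ^ n)) with (s * p ^ n * p) by ring.
replace (b * s * p ^ n) with (b * (s * p ^ n)) by ring.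
rewrite (Rmult_assoc (qpoch (b * s) p n)), <- qbin_step; auto.
- transitivity (qpoch s p n * qbin b p s * (1 - s * p ^ n)); [ring|].
  rewrite IH; ring.
- apply Rabs_mult_lt_1; [exact Hs|].
  apply Rabs_pow_le1; rewrite Rabs_pos_eq; lra.
Qed.

(** For negative [s] the signs alternate, so the terms alone do not decide. Iterating the functional
    equation moves the argument close to 0, where the constant term 1 dominates, and the factors
    picked up on the way are positive. *)
Lemma qbin_pos (b p s : R) : 0 <= b < 1 -> 0 <= p < 1 -> Rabs s < 1 ->
  0 < qbin b p s.
Proof.
intros Hb Hp Hs.
destruct (qbin_coef_bounded b p Hb Hp) as [M [HM H]].
(* Below [/ (4 * M)], which is at most 1/4, the series [T] after the constant term satisfies
   [Rabs T <= 2 * M], hence [Rabs (z * T) <= 1 / 2]. *)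
destruct (pow_lt_1_zero p) with (y := / (4 * M)) as [n Hn];
  [rewrite Rabs_pos_eq; lra|apply Rinv_0_lt_compat; lra|].
specialize (Hn n (le_n n)).
set (z := s * p ^ n).
assert (HMi : / (4 * M) <= / 4) by (apply Rinv_le_contravar; lra).
assert (Hz : Rabs z < / (4 * M)).
{ unfold z; rewrite Rabs_mult.
  generalize (Rabs_pos (p ^ n)) (Rabs_pos s); nra. }
assert (Hpos : 0 < qbin b p z).
{ unfold qbin; rewrite Series_incr_1 by (apply qbin_ex_series; lra).
  rewrite (Series_ext _ (fun k => z * (qpoch b p (S k) / qpoch p p (S k) * z ^ k)))
    by (intros; cbn [pow]; ring).
  rewrite Series_scal_l; simpl (qpoch _ _ 0); simpl (z ^ 0).
  generalize (Rabs_Series_bounded_pow (fun k => qpoch b p (S k) / qpoch p p (S k)) M z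
    (fun k => H (S k)) ltac:(lra)).
  set (T := Series _); intros HT.
  assert (HT2 : Rabs T <= M * 2).
  { eapply Rle_trans; [exact HT|]; apply Rmult_le_compat_l; [lra|].
    rewrite <- (Rinv_inv 2); apply Rinv_le_contravar; lra. }
  assert (Rabs (z * T) <= / 2).
  { rewrite Rabs_mult; replace (/ 2) with (/ (4 * M) * (M * 2)) by (field; lra).
    apply Rmult_le_compat; try apply Rabs_pos; lra. }
  assert (HzT : - Rabs (z * T) <= z * T)
    by (generalize (Rle_abs (- (z * T))); rewrite Rabs_Ropp; lra).
  lra. }
generalize (qbin_iter b p s n Hb Hp Hs); fold z; intros E.
assert (H1 : 0 < qpoch s p n) by now apply qpoch_pos.
assert (H2 : 0 < qpoch (b * s) p n).
{ apply qpoch_pos; auto; rewrite Rmult_comm; apply Rabs_mult_lt_1; auto.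
  rewrite Rabs_pos_eq; lra. }
apply Rmult_lt_reg_l with (qpoch s p n); auto.
rewrite Rmult_0_r, E; now apply Rmult_lt_0_compat.
Qed.

(** Termwise, [(1 - b)] times the series for [b * p] is the series for [b] at [s] minus [b] times
    its value at [s * p]; [qbin_step] then eliminates the value at [s * p]. *)
Lemma qbin_mul_base (b p s : R) : 0 <= b < 1 -> 0 <= p < 1 -> Rabs s < 1 ->
  (1 - b * s) * qbin (b * p) p s = qbin b p s.
Proof.
intros Hb Hp Hs.
assert (Hsp : Rabs (s * p) < 1)
  by (apply Rabs_mult_lt_1; [|rewrite Rabs_pos_eq]; lra).
assert (Hbs : Rabs (s * b) < 1)
  by (apply Rabs_mult_lt_1; [|rewrite Rabs_pos_eq]; lra).
apply Rabs_def2 in Hbs.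
assert (H : (1 - b) * qbin (b * p) p s = qbin b p s + (- b) * qbin b p (s * p)).
{ unfold qbin; rewrite <- !Series_scal_l, <- Series_plus;
    try apply ex_series_Rscal; try now apply qbin_ex_series.
  apply Series_ext; intros k.
  transitivity (((1 - b) * qpoch (b * p) p k) / qpoch p p k * s ^ k);
    [unfold Rdiv; ring|].
  rewrite <- qpoch_shift, Rpow_mult_distr; cbn [qpoch]; unfold Rdiv; ring. }
generalize (qbin_step b p s Hb Hp Hs); intros E.
apply Rmult_eq_reg_l with (1 - b); [|lra].
transitivity ((1 - b * s) * ((1 - b) * qbin (b * p) p s)); [ring|].
rewrite H.
transitivity ((1 - b * s) * qbin b p s - b * ((1 - b * s) * qbin b p (s * p))); [ring|].
rewrite <- E; ring.
Qed.

(** The two sums are coupled only through [p^(k*j)], which can be attached to either variable and is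
    at most 1 in absolute value, so a product of geometric bounds dominates. *)
Lemma Series_qbin_exchange (c : nat -> R) (M b p s T : R) :
  (forall k, Rabs (c k) <= M) -> 0 <= b < 1 -> 0 <= p < 1 ->
  Rabs s < 1 -> Rabs T < 1 ->
  Series (fun k => c k * T ^ k * qbin b p (s * p ^ k)) =
  Series (fun j => qpoch b p j / qpoch p p j * s ^ j *
                   Series (fun k => c k * (T * p ^ j) ^ k)).
Proof.
intros Hc Hb Hp Hs HT.
destruct (qbin_coef_bounded b p Hb Hp) as [N [HN H]].
set (f := fun k j => c k * T ^ k * (qpoch b p j / qpoch p p j * (s * p ^ k) ^ j)).
transitivity (Series (fun k => Series (fun j => f k j))).
{ apply Series_ext; intros k; unfold f; now rewrite Series_scal_l. }
rewrite (Series_exchange f (fun k => M * Rabs T ^ k) (fun j => N * Rabs s ^ j)).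
- apply Series_ext; intros j; rewrite <- Series_scal_l.
  apply Series_ext; intros k; unfold f.
  rewrite !Rpow_mult_distr, <- !pow_mult, (Nat.mul_comm k j); ring.
- intros k j; unfold f; rewrite Rabs_mult.
  apply Rmult_le_compat; try apply Rabs_pos.
  + now apply Rabs_bounded_pow_le.
  + rewrite Rpow_mult_distr, <- Rmult_assoc, Rabs_mult.
    rewrite <- (Rmult_1_r (N * _)).
    apply Rmult_le_compat; try apply Rabs_pos.
    * now apply (Rabs_bounded_pow_le (fun j => qpoch b p j / qpoch p p j)).
    * rewrite <- pow_mult; apply Rabs_pow_le1; rewrite Rabs_pos_eq; lra.
- now apply ex_series_Rabs_pow.
- now apply ex_series_Rabs_pow.
Qed.

(** * Even and odd parts of the q-exponential, and the weights *)

(** With [z = y ^ 2], this and [y] times the next series are the even and odd parts of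
    [1 / (y;q)_oo], that is of [qbin 0 q y]. *)
Definition qexp_even (q z : R) : R := Series (fun k => / qpoch q q (2 * k) * z ^ k).

Definition qexp_odd (q z : R) : R := Series (fun k => / qpoch q q (2 * k + 1) * z ^ k).

Lemma qbin_even_odd (q y : R) : 0 <= q < 1 -> Rabs y < 1 ->
  qbin 0 q y = qexp_even q (y ^ 2) + y * qexp_odd q (y ^ 2).
Proof.
intros Hq Hy.
destruct (inv_qpoch_bounded q q Hq Hq) as [M [_ H]].
assert (Hy2 : Rabs (y ^ 2) < 1)
  by (simpl; rewrite Rmult_1_r; apply Rabs_mult_lt_1; lra).
set (c := fun n => / qpoch q q n).
transitivity (PSeries c y).
{ apply Series_ext; intros n; unfold c; rewrite qpoch_zero; unfold Rdiv; ring. }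
apply PSeries_odd_even.
- apply ex_series_ext with (fun n => c (2 * n)%nat * (y ^ 2) ^ n).
  + intros n; rewrite Rmult_comm, <- pow_n_pow; reflexivity.
  + apply ex_series_bounded_pow with M; auto; intros k; apply H.
- apply ex_series_ext with (fun n => c (2 * n + 1)%nat * (y ^ 2) ^ n).
  + intros n; rewrite Rmult_comm, <- pow_n_pow; reflexivity.
  + apply ex_series_bounded_pow with M; auto; intros k; apply H.
Qed.

(** The values of [qbin 0 q] at [y] and [- y] are even part plus and minus odd part. Both are
    positive, and the weight is a convex combination of them. *)
Lemma qexp_weight_nonneg (q r y : R) : 0 <= q < 1 -> 0 <= r <= 1 -> Rabs y < 1 ->
  0 <= qexp_even q (y ^ 2) + r * (y * qexp_odd q (y ^ 2)).
Proof.
intros Hq Hr Hy.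
assert (Hy' : Rabs (- y) < 1) by now rewrite Rabs_Ropp.
generalize (qbin_pos 0 q y ltac:(lra) Hq Hy) (qbin_pos 0 q (- y) ltac:(lra) Hq Hy').
rewrite !qbin_even_odd by auto.
replace ((- y) ^ 2) with (y ^ 2) by ring.
intros H1 H2; nra.
Qed.

(* The kernel in the variables [a = q^(2 nu + 2)] and [t = (1 - q) x]. *)
Definition qDunkl_series (q a t : R) : R :=
  Series (fun k => / (qpoch (q ^ 2) (q ^ 2) k * qpoch a (q ^ 2) k) * (t ^ 2) ^ k) +
  t / (1 - a) *
  Series (fun k => / (qpoch (q ^ 2) (q ^ 2) k * qpoch (a * q ^ 2) (q ^ 2) k) * (t ^ 2) ^ k).

(** This is [W_j(t)]. Relative to the even part, the odd part carries an extra [q ^ (2 * j)]: one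
    [q ^ j] completes the argument [t * q ^ j], the other remains as the damping factor in [0,1]. *)
Definition qDunkl_weight (q t : R) (j : nat) : R :=
  qexp_even q ((t * q ^ j) ^ 2) + q ^ j * (t * q ^ j * qexp_odd q ((t * q ^ j) ^ 2)).

Lemma qexp_bounded (q t : R) : 0 <= q < 1 -> Rabs t < 1 ->
  exists M, forall y, Rabs y <= 1 ->
    Rabs (qexp_even q ((t * y) ^ 2)) <= M /\ Rabs (qexp_odd q ((t * y) ^ 2)) <= M.
Proof.
intros Hq Ht.
destruct (inv_qpoch_bounded q q Hq Hq) as [M [HM H]].
exists (M / (1 - t ^ 2)); intros y Hy.
assert (Ht2 : 0 <= t ^ 2 < 1)
  by (rewrite <- pow2_abs; generalize (Rabs_pos t); split; nra).
assert (Hyt : 0 <= (t * y) ^ 2 <= t ^ 2).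
{ split; [apply pow2_ge_0|]; rewrite Rpow_mult_distr, <- (pow2_abs y).
  assert (Rabs y ^ 2 <= 1) by (generalize (Rabs_pos y); nra); nra. }
assert (HD : forall c : nat -> R, (forall k, Rabs (c k) <= M) ->
  Rabs (Series (fun k => c k * ((t * y) ^ 2) ^ k)) <= M / (1 - t ^ 2)).
{ intros c Hc; eapply Rle_trans.
  - apply Rabs_Series_bounded_pow with (M := M); [exact Hc|rewrite Rabs_pos_eq; lra].
  - rewrite Rabs_pos_eq by lra.
    apply Rmult_le_compat_l; [lra|apply Rinv_le_contravar; lra]. }
split; apply HD; intros k; apply H.
Qed.

Lemma qDunkl_weight_nonneg (q t : R) (j : nat) : 0 <= q < 1 -> Rabs t < 1 ->
  0 <= qDunkl_weight q t j.
Proof.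
intros Hq Ht.
assert (Hqj : 0 <= q ^ j) by (apply pow_le; lra).
assert (Hqj1 : Rabs (q ^ j) <= 1) by (apply Rabs_pow_le1; rewrite Rabs_pos_eq; lra).
assert (Hy : Rabs (t * q ^ j) < 1) by now apply Rabs_mult_lt_1.
rewrite Rabs_pos_eq in Hqj1 by lra.
apply qexp_weight_nonneg; lra.
Qed.

Lemma ex_series_coef_bounded_pow (b p s M : R) (g : nat -> R) :
  0 <= b < 1 -> 0 <= p < 1 -> Rabs s < 1 -> (forall j, Rabs (g j) <= M) ->
  ex_series (fun j => qpoch b p j / qpoch p p j * s ^ j * g j).
Proof.
intros Hb Hp Hs Hg; destruct (qbin_coef_bounded b p Hb Hp) as [N [HN H]].
apply ex_series_Rabs_le with (fun j => M * (N * Rabs s ^ j)).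
- intros j; rewrite Rabs_mult, Rmult_comm.
  apply Rmult_le_compat; try apply Rabs_pos; auto.
  now apply (Rabs_bounded_pow_le (fun j => qpoch b p j / qpoch p p j)).
- now apply ex_series_Rscal, ex_series_Rabs_pow.
Qed.

(** The even and odd series of the kernel are expanded separately, each by [qbin_iter] followed by
    an exchange of sums, and recombined into the weights. *)
Lemma qDunkl_series_weights (q b t : R) : 0 < q < 1 -> 0 <= b < 1 -> Rabs t < 1 ->
  qbin b (q ^ 2) q * qDunkl_series q (b * q) t =
  Series (fun j => qpoch b (q ^ 2) j / qpoch (q ^ 2) (q ^ 2) j * q ^ j *
                   qDunkl_weight q t j).
Proof.
intros Hq Hb Ht.
destruct (inv_qpoch_bounded q q ltac:(lra) ltac:(lra)) as [M [HM H]].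
destruct (qexp_bounded q t ltac:(lra) Ht) as [B HB].
set (p := q ^ 2).
assert (Hp : 0 <= p < 1) by (unfold p; split; nra).
assert (Hqa : Rabs q < 1) by (rewrite Rabs_pos_eq; lra).
assert (Hqp : Rabs (q * p) < 1)
  by (apply Rabs_mult_lt_1; [|rewrite Rabs_pos_eq]; lra).
assert (Hbq : Rabs (b * q) < 1)
  by (rewrite Rmult_comm; apply Rabs_mult_lt_1; [|rewrite Rabs_pos_eq]; lra).
assert (Ht2 : Rabs (t ^ 2) < 1)
  by (simpl; rewrite Rmult_1_r; apply Rabs_mult_lt_1; lra).
assert (Hpk : forall k, qpoch p p k <> 0)
  by (intros k; apply Rgt_not_eq, qpoch_pos; [rewrite Rabs_pos_eq|]; lra).
assert (Hqk : forall k, qpoch q p k <> 0)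
  by (intros k; apply Rgt_not_eq, qpoch_pos; lra).
assert (Hak : forall k, qpoch (b * q) p k <> 0)
  by (intros k; apply Rgt_not_eq, qpoch_pos; lra).
assert (Heven : qbin b p q *
  Series (fun k => / (qpoch p p k * qpoch (b * q) p k) * (t ^ 2) ^ k) =
  Series (fun j => qpoch b p j / qpoch p p j * q ^ j * qexp_even q ((t * q ^ j) ^ 2))).
{ transitivity (Series (fun k => / qpoch q q (2 * k) * (t ^ 2) ^ k * qbin b p (q * p ^ k))).
  - rewrite <- Series_scal_l; apply Series_ext; intros k.
    rewrite qpoch_even; fold p.
    generalize (qbin_iter b p q k Hb Hp Hqa) (Hpk k) (Hqk k) (Hak k); intros E E1 E2 E3.
    apply Rmult_eq_reg_l with (qpoch q p k); auto.
    rewrite <- Rmult_assoc, E; now field.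
  - rewrite (Series_qbin_exchange (fun k => / qpoch q q (2 * k)) M); auto.
    apply Series_ext; intros j; f_equal; unfold qexp_even, p.
    now rewrite Rpow_mult_distr, <- !pow_mult, (Nat.mul_comm 2 j). }
assert (Hodd : qbin b p q * (/ (1 - b * q) *
  Series (fun k => / (qpoch p p k * qpoch (b * q * p) p k) * (t ^ 2) ^ k)) =
  Series (fun j => qpoch b p j / qpoch p p j * (q * p) ^ j * qexp_odd q ((t * q ^ j) ^ 2))).
(* The odd series needs [S k] iterations: [(q;q)_(2k+1)] contains [(q;p)_(k+1)], and [1 - b * q]
   completes [(bqp;p)_k] to [(bq;p)_(k+1)]. The exchange therefore starts from [q * p] instead of
   [q]. *)
{ transitivity (Series (fun k =>
    / qpoch q q (2 * k + 1) * (t ^ 2) ^ k * qbin b p (q * p * p ^ k))).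
  - rewrite <- !Series_scal_l; apply Series_ext; intros k.
    rewrite qpoch_odd; fold p.
    rewrite <- (Rmult_assoc (/ _)), <- Rinv_mult.
    replace (q * p * p ^ k) with (q * p ^ S k) by (simpl; ring).
    replace ((1 - b * q) * (qpoch p p k * qpoch (b * q * p) p k))
      with (qpoch p p k * qpoch (b * q) p (S k)) by (rewrite qpoch_shift; ring).
    generalize (qbin_iter b p q (S k) Hb Hp Hqa) (Hpk k) (Hqk (S k)) (Hak (S k)).
    intros E E1 E2 E3.
    apply Rmult_eq_reg_l with (qpoch q p (S k)); auto.
    rewrite <- Rmult_assoc, E; field; auto.
  - rewrite (Series_qbin_exchange (fun k => / qpoch q q (2 * k + 1)) M); auto.
    apply Series_ext; intros j; f_equal; unfold qexp_odd, p.
    now rewrite Rpow_mult_distr, <- !pow_mult, (Nat.mul_comm 2 j). }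
assert (Hqj1 : forall j, Rabs (q ^ j) <= 1) by (intros j; apply Rabs_pow_le1; lra).
unfold qDunkl_series; fold p.
transitivity (qbin b p q *
    Series (fun k => / (qpoch p p k * qpoch (b * q) p k) * (t ^ 2) ^ k) +
  t * (qbin b p q * (/ (1 - b * q) *
    Series (fun k => / (qpoch p p k * qpoch (b * q * p) p k) * (t ^ 2) ^ k))));
  [unfold Rdiv; ring|].
rewrite Heven, Hodd, <- Series_scal_l, <- Series_plus.
- apply Series_ext; intros j; unfold qDunkl_weight, p.
  rewrite (Rpow_mult_distr q), <- (pow_mult q), Nat.mul_comm, (pow_mult q); ring.
- apply ex_series_coef_bounded_pow with B; auto; intros j; now apply HB.
- apply ex_series_Rscal, ex_series_coef_bounded_pow with B; auto; intros j; now apply HB.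
Qed.

Lemma qDunkl_weight_bounded (q t : R) : 0 <= q < 1 -> Rabs t < 1 ->
  exists M, forall j, Rabs (qDunkl_weight q t j) <= M.
Proof.
intros Hq Ht; destruct (qexp_bounded q t Hq Ht) as [B HB].
exists (B + B); intros j; unfold qDunkl_weight.
assert (Hqj : Rabs (q ^ j) <= 1) by (apply Rabs_pow_le1; rewrite Rabs_pos_eq; lra).
destruct (HB (q ^ j) Hqj) as [H1 H2].
eapply Rle_trans; [apply Rabs_triang|]; apply Rplus_le_compat; auto.
rewrite !Rabs_mult, <- Rmult_assoc, <- (Rmult_1_l B).
apply Rmult_le_compat; auto using Rabs_pos.
- apply Rmult_le_pos; [|apply Rmult_le_pos]; apply Rabs_pos.
- generalize (Rabs_pos (q ^ j)) (Rabs_pos t); intros.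
  assert (Rabs t * Rabs (q ^ j) <= 1) by nra.
  assert (0 <= Rabs t * Rabs (q ^ j)) by nra; nra.
Qed.

(** * The inequality for the series, and the divergent range *)

Lemma qpoch_coef_shift (b p : R) (j : nat) : 0 <= b < 1 ->
  qpoch (b * p) p j = qpoch b p j * (1 - b * p ^ j) / (1 - b).
Proof.
intros Hb; generalize (qpoch_shift b p j); cbn [qpoch]; intros ->; field; lra.
Qed.

(* With [b = q^(2 nu + 1)] the prefactors are [C(nu) / C(nu+1)] and [C(nu+1) / C(nu+2)]. *)
Lemma qDunkl_series_Turan (q b t : R) : 0 < q < 1 -> 0 <= b < 1 -> Rabs t < 1 ->
  (1 - b) / (1 - b * q) * qDunkl_series q (b * q ^ 2 * q) t ^ 2 <=
  (1 - b * q ^ 2) / (1 - b * q ^ 2 * q) *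
    (qDunkl_series q (b * q) t * qDunkl_series q (b * q ^ 2 * q ^ 2 * q) t).
Proof.
intros Hq Hb Ht.
set (p := q ^ 2).
assert (Hp : 0 < p < 1) by (unfold p; split; nra).
assert (Hbp : 0 <= b * p < 1) by (split; nra).
assert (Hbpp : 0 <= b * p * p < 1) by (split; nra).
assert (Hqa : Rabs q < 1) by (rewrite Rabs_pos_eq; lra).
assert (Hbq : 0 < 1 - b * q) by nra.
assert (Hbpq : 0 < 1 - b * p * q) by nra.
destruct (qDunkl_weight_bounded q t ltac:(lra) Ht) as [M HM].
set (A := fun j => qpoch b p j / qpoch p p j * q ^ j * qDunkl_weight q t j).
set (u := fun j => 1 - b * p ^ j).
assert (Hpj : forall j, 0 <= p ^ j <= 1).
{ intros j; generalize (Rabs_pow_le1 p j).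
  rewrite !Rabs_pos_eq by (try apply pow_le; lra).
  split; [apply pow_le|]; lra. }
assert (Hbpj : forall j, 0 <= b * p ^ j <= 1) by (intros j; specialize (Hpj j); nra).
assert (HA : forall j, 0 <= A j).
{ intros j; unfold A; repeat apply Rmult_le_pos.
  - left; apply qpoch_bounds; lra.
  - left; apply Rinv_0_lt_compat, qpoch_bounds; lra.
  - apply pow_le; lra.
  - apply qDunkl_weight_nonneg; lra. }
assert (HS : ex_series A) by (apply ex_series_coef_bounded_pow with M; auto; lra).
assert (Hu : forall j, Rabs (u j) <= 1).
{ intros j; specialize (Hbpj j); unfold u; rewrite Rabs_pos_eq; lra. }
generalize (Series_Cauchy_Schwarz A u HA Hu HS); intros HCS.
(* Raising the order by two multiplies the terms by [u j * u (S j)] up to a constant, whereas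
   Cauchy-Schwarz yields [u j ^ 2]; monotonicity of [u] closes the gap. *)
assert (H2 : Series (fun j => A j * u j ^ 2) <= Series (fun j => A j * (u j * u (S j)))).
{ apply Series_le.
  - intros j; specialize (HA j); specialize (Hbpj j) as Hbj; specialize (Hpj j).
    assert (0 <= u j <= u (S j)) by (unfold u; simpl; split; nra).
    split; [apply Rmult_le_pos; [lra|apply pow2_ge_0]|].
    apply Rmult_le_compat_l; [lra|nra].
  - apply ex_series_Rabs_le with A; auto.
    intros j; specialize (HA j); specialize (Hbpj j) as Hbj.
    specialize (Hbpj (S j)) as HbSj; unfold u.
    rewrite Rabs_pos_eq; [|apply Rmult_le_pos; nra].
    assert ((1 - b * p ^ j) * (1 - b * p ^ S j) <= 1) by nra; nra. }
assert (HS0 : 0 <= Series A) by now apply Series_nonneg.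
generalize (qDunkl_series_weights q b t Hq Hb Ht)
  (qDunkl_series_weights q (b * p) t Hq Hbp Ht)
  (qDunkl_series_weights q (b * p * p) t Hq Hbpp Ht).
fold p; fold A; intros E0 E1 E2.
assert (HF : 0 < qbin b p q) by (apply qbin_pos; lra).
assert (F1 : qbin (b * p) p q = qbin b p q / (1 - b * q)).
{ rewrite <- (qbin_mul_base b p q) by lra; field; lra. }
assert (F2 : qbin (b * p * p) p q = qbin (b * p) p q / (1 - b * p * q)).
{ rewrite <- (qbin_mul_base (b * p) p q) by lra; field; lra. }
rewrite F2, F1 in E2; rewrite F1 in E1.
rewrite (Series_ext _ (fun j => / (1 - b) * (A j * u j))) in E1.
2:{ intros j; rewrite qpoch_coef_shift by lra; unfold A, u; unfold Rdiv; ring. }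
rewrite (Series_ext _ (fun j => / (1 - b) * / (1 - b * p) * (A j * (u j * u (S j))))) in E2.
2:{ intros j; rewrite !qpoch_coef_shift by lra; unfold A, u; simpl; unfold Rdiv; ring. }
rewrite Series_scal_l in E1, E2.
set (F := qbin b p q) in *.
set (K0 := qDunkl_series q (b * q) t) in *.
set (K1 := qDunkl_series q (b * p * q) t) in *.
set (K2 := qDunkl_series q (b * p * p * q) t) in *.
set (S0 := Series A) in *.
set (S1 := Series (fun j => A j * u j)) in *.
set (S2 := Series (fun j => A j * (u j * u (S j)))) in *.
assert (G0 : K0 = S0 / F) by (rewrite <- E0; field; lra).
assert (G1 : K1 = (1 - b * q) / (1 - b) * S1 / F).
{ replace S1 with ((1 - b) * (/ (1 - b) * S1)) by (field; lra).
  rewrite <- E1; field; lra. }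
assert (G2 : K2 = (1 - b * q) * (1 - b * p * q) / ((1 - b) * (1 - b * p)) * S2 / F).
{ replace S2 with ((1 - b) * (1 - b * p) * (/ (1 - b) * / (1 - b * p) * S2)) by (field; lra).
  rewrite <- E2; field; lra. }
rewrite G0, G1, G2.
(* The prefactors reduce both sides to one common positive factor, leaving [S1 ^ 2 <= S0 * S2]. *)
replace (_ * _) with ((1 - b * q) / ((1 - b) * F ^ 2) * S1 ^ 2) by (field; lra).
replace ((1 - b * p) / _ * _) with ((1 - b * q) / ((1 - b) * F ^ 2) * (S0 * S2))
  by (field; lra).
apply Rmult_le_compat_l; [|nra].
left; apply Rdiv_lt_0_compat; [lra|apply Rmult_lt_0_compat; nra].
Qed.

(* A divergence statement: the partial sums tend to [p_infty], which [real] maps to 0. *)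
Lemma Series_ge_one (a : nat -> R) : (forall n, 1 <= a n) -> Series a = 0.
Proof.
intros Ha; unfold Series; rewrite (is_lim_seq_unique _ p_infty); [reflexivity|].
apply is_lim_seq_le_p_loc with INR; [|exact is_lim_seq_INR].
exists 0%nat; intros n _; induction n as [|n IH].
- rewrite sum_O; simpl; generalize (Ha 0%nat); lra.
- rewrite sum_Sn, S_INR; unfold plus; simpl; generalize (Ha (S n)); lra.
Qed.

(** The products in the denominators lie in (0,1] and [t ^ 2 >= 1], so every term of both series is
    at least 1. *)
Lemma qDunkl_series_divergent (q a t : R) : 0 < q < 1 -> 0 <= a < 1 -> 1 <= Rabs t ->
  qDunkl_series q a t = 0.
Proof.
intros Hq Ha Ht.
assert (Hp : 0 < q ^ 2 < 1) by (split; nra).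
assert (H : forall c k, 0 <= c < 1 ->
  1 <= / (qpoch (q ^ 2) (q ^ 2) k * qpoch c (q ^ 2) k) * (t ^ 2) ^ k).
{ intros c k Hc.
  generalize (qpoch_bounds (q ^ 2) (q ^ 2) k ltac:(lra) ltac:(lra)); intros B1.
  generalize (qpoch_bounds c (q ^ 2) k Hc ltac:(lra)); intros B2.
  rewrite <- (Rmult_1_l 1); apply Rmult_le_compat; try lra.
  - rewrite <- Rinv_1; apply Rinv_le_contravar; nra.
  - apply pow_R1_Rle; rewrite <- (pow2_abs t); nra. }
unfold qDunkl_series; rewrite !Series_ge_one; [ring| |];
  intros k; apply H; split; nra.
Qed.

(** * Return to the kernel and its normalization *)

(** In the odd part [(1 + q) * [nu+1]_p] equals [(1 - a) / (1 - q)] for [p = q ^ 2] and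
    [a = q^(2 nu + 2)], which turns the prefactor into [t / (1 - a)]. *)
Lemma qDunklE (q nu x : R) : 0 < q < 1 -> 0 < nu ->
  qDunkl q nu x = qDunkl_series q (Rpower q (2 * nu + 1) * q) ((1 - q) * x).
Proof.
intros Hq Hnu.
assert (Hp : 0 < q ^ 2 < 1) by (split; nra).
assert (Hr : Rpower q (2 * nu + 1) * q = Rpower q (2 * nu + 2)).
{ replace (2 * nu + 2) with (2 * nu + 1 + 1) by ring.
  now rewrite (Rpower_plus (2 * nu + 1)), Rpower_1 by lra. }
assert (Hr2 : Rpower q (2 * (nu + 1) + 2) = Rpower q (2 * nu + 2) * q ^ 2).
{ replace (2 * (nu + 1) + 2) with (2 * nu + 2 + INR 2) by (simpl; ring).
  now rewrite (Rpower_plus (2 * nu + 2)), Rpower_pow by lra. }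
generalize (Rpower_lt_1 q (2 * nu + 2) Hq ltac:(lra)); intros HR.
assert (HG : forall y, 0 < y -> qGamma (q ^ 2) y <> 0)
  by (intros y Hy; apply Rgt_not_eq, qGamma_pos; auto).
unfold qDunkl, qDunkl_series; rewrite !qBesselI_norm_series by (auto; apply HG; lra).
unfold qnum; rewrite Rpower_sqr_base, Hr, Hr2 by lra.
replace (2 * (nu + 1)) with (2 * nu + 2) by ring.
f_equal; [|f_equal].
- apply Series_ext; intros k; rewrite pow_mult; unfold Rdiv; ring.
- field; repeat split; nra.
- apply Series_ext; intros k; rewrite pow_mult; unfold Rdiv; ring.
Qed.

Theorem theorem4 (q x : R) (hq : 0 < q < 1) (hx : Rabs x < 1 / (1 - q) ^ 2) :
  forall nu : R, 0 < nu ->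
    (qDunkl_norm q (nu + 1) x) ^ 2 <= qDunkl_norm q nu x * qDunkl_norm q (nu + 2) x.
Proof.
intros nu hnu.
assert (Hr : forall y, Rpower q (2 * (y + 1) + 1) = Rpower q (2 * y + 1) * q ^ 2).
{ intros y; replace (2 * (y + 1) + 1) with (2 * y + 1 + INR 2) by (simpl; ring).
  now rewrite (Rpower_plus (2 * y + 1)), Rpower_pow by lra. }
replace (nu + 2) with (nu + 1 + 1) by ring.
generalize (Rpower_lt_1 q (2 * nu + 1) hq ltac:(lra)); intros HR.
unfold qDunkl_norm; rewrite !qDunklE, !qDunkl_const_succ, !Hr by lra.
set (b := Rpower q (2 * nu + 1)) in *.
set (t := (1 - q) * x).
assert (Hp : 0 < q ^ 2 < 1) by (split; nra).
assert (Hbq : 0 < 1 - b * q) by nra.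
assert (Hbp : 0 < b * q ^ 2 < 1) by (split; nra).
assert (Hbpq : 0 < 1 - b * q ^ 2 * q) by nra.
(* The bound on [x] only gives [Rabs t < 1 / (1 - q)], so the range [1 <= Rabs t] has to be treated
   as well. *)
destruct (Rlt_le_dec (Rabs t) 1) as [Ht|Ht].
- generalize (qDunkl_series_Turan q b t hq ltac:(lra) Ht).
  set (K0 := qDunkl_series q (b * q) t).
  set (K1 := qDunkl_series q (b * q ^ 2 * q) t).
  set (K2 := qDunkl_series q (b * q ^ 2 * q ^ 2 * q) t).
  set (g := / qDunkl_const q nu); intros HT.
  unfold Rdiv; rewrite !Rinv_mult; fold g.
  (* Both sides share the factor [g ^ 2 * ((1 - b) / (1 - b * q))]; it is nonnegative, as [g] enters
     only squared. *)
  apply Rle_trans with (g ^ 2 * ((1 - b) / (1 - b * q)) *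
    ((1 - b) / (1 - b * q) * K1 ^ 2)); [right; field; lra|].
  apply Rle_trans with (g ^ 2 * ((1 - b) / (1 - b * q)) *
    ((1 - b * q ^ 2) / (1 - b * q ^ 2 * q) * (K0 * K2))); [|right; field; lra].
  apply Rmult_le_compat_l; [|exact HT].
  apply Rmult_le_pos; [apply pow2_ge_0|left; apply Rdiv_lt_0_compat; lra].
- rewrite !qDunkl_series_divergent by (try split; nra).
  unfold Rdiv; lra.
Qed.
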